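(* In the general framework described in the context, with either DOF-extended ($\bullet=\mathsf e$) or DOF-continuous ($\bullet=\mathsf c$) multiscale basis functions, let $\mathbb A^{\varepsilon,\mathsf G}_{j,i}=\sum_{K\in\mathcal T_H}a_K^\varepsilon(\phi_i^\varepsilon,\phi_j^\varepsilon)$, $1\le i,j\le N_0$, be the matrix of the Galerkin MsFEM (find $u_H^\varepsilon\in V_{H,0}^\varepsilon$ with $\sum_K a_K^\varepsilon(u_H^\varepsilon,v_H^\varepsilon)=F(v_H^\varepsilon)$ for all $v_H^\varepsilon\in V_{H,0}^\varepsilon$). For $K\in\mathcal T_H$ define on $K$ the constants ($1\le\alpha,\beta\le d$) $$\overline M^{\mathsf G}|_K=\tfrac1{|K|}\big[a_K^\varepsilon(W_K^0,1)+a_K^\varepsilon(W_K^0,\chi_K^{0,\bullet})\big],\qquad \overline B^{1,\mathsf G}_\alpha|_K=\tfrac1{|K|}\big[a_K^\varepsilon(W_K^\alpha,1)+a_K^\varepsilon(W_K^\alpha,\chi_K^{0,\bullet})\big],$$ $$\overline B^{2,\mathsf G}_\beta|_K=\tfrac1{|K|}\big[a_K^\varepsilon(W_K^0,x^\beta-x^\beta_{c,K})+a_K^\varepsilon(W_K^0,\chi_K^{\beta,\bullet})\big],\qquad \overline A^{\mathsf G}_{\beta,\alpha}|_K=\tfrac1{|K|}\big[a_K^\varepsilon(W_K^\alpha,x^\beta-x^\beta_{c,K})+a_K^\varepsilon(W_K^\alpha,\chi_K^{\beta,\bullet})\big],$$ and $$\overline a_K^{\mathsf G}(u,v)=\int_K\nabla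 v\cdot\overline A^{\mathsf G}\nabla u+v\,(\overline B^{1,\mathsf G}\cdot\nabla u)+u\,(\overline B^{2,\mathsf G}\cdot\nabla v)+\overline M^{\mathsf G}u\,v .$$ Let $\mathbb A^{P_1,\mathsf G}_{j,i}=\sum_{K\in\mathcal T_H}\overline a_K^{\mathsf G}(\phi_i,\phi_j)$, $1\le i,j\le N_0$, where each integral over $K$ in $\overline a_K^{\mathsf G}$ is evaluated by the one-point rule at the centroid, i.e. $\int_K g$ is replaced by $|K|\,g(x_{c,K})$. Then $\mathbb A^{\varepsilon,\mathsf G}=\mathbb A^{P_1,\mathsf G}$.
   Context: Problem. $\Omega\subset\mathbb R^d$ ($d\ge1$) is a bounded polytope and $\mathcal T_H$ a conformal simplicial mesh of $\Omega$. $H^1(\mathcal T_H)=\{u\in L^2(\Omega): u|_K\in H^1(K)\ \forall K\in\mathcal T_H\}$; $P_1(\mathcal T_H)$ is the space of functions that are affine on each $K\in\mathcal T_H$. For each $K\in\mathcal T_H$, $a_K^\varepsilon$ is a continuous bilinear form on $H^1(K)\times H^1(K)$, and $a^\varepsilon=\sum_K a_K^\varepsilon$ is coercive on $H_0^1(\Omega)$. Moreover for each $K$ there is $\alpha_K>0$ with $a_K^\varepsilon(u,u)\ge\alpha_K\|\nabla u\|_{L^2(K)}^2$ for all $u\in H^1(K)$. $f\in L^2(\Omega)$ and $F(v)=\int_\Omega f v$. $x_{c,K}$ is the centroid of $K$, $x^\alpha$ the $\alpha$-th coordinate function, $x_{c,K}^\alpha$ the $\alpha$-th coordinate of $x_{c,K}$.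 Underlying $P_1$ space and degrees of freedom. $V_H$ is one of: (MsFEM-lin) the space of functions in $P_1(\mathcal T_H)$ continuous on $\Omega$; (MsFEM-CR) the Crouzeix-Raviart space of $v\in P_1(\mathcal T_H)$ whose jump has zero integral over every interior face. For a simplex $K$ and $v\in P_1(K)$, the degree-of-freedom (DOF) operator $\Gamma(K,v)\in\mathbb R^{d+1}$ is the vector of values of $v$ at the $d+1$ vertices of $K$ (MsFEM-lin), or of averages of $v$ over the $d+1$ faces of $K$ (MsFEM-CR). The degrees of freedom attached to mesh vertices (resp. faces) lying on $\partial\Omega$ are said to be associated to the boundary. $V_{H,0}$ is the space of $v\in V_H$ all of whose degrees of freedom associated to the boundary vanish. $\phi_1,\dots,\phi_N$ is the basis of $V_H$ dual to the vertices (lin) or to the faces (CR) of the mesh (value, resp. face average, $\delta_{ij}$), ordered so that $\phi_1,\dots,\phi_{N_0}$ is a basis of $V_{H,0}$. Oversampling. For each $K\in\mathcal T_H$, $S_K=S_K'\cap\Omega$ where $S_K'$ is the image of $K$ under a homothety centred at the centroid of $K$ with ratio $\rho\ge1$. If $S_K=K$ for all $K$ the method is ''without oversampling''. $\Gamma(S_K,v)$, $v\in P_1(S_K)$, is: (lin) the values of $v$ at $d+1$ chosen distinct vertices of $S_K$; (CR) the averages of $v$ over the $d+1$ dilated faces of $S_K$, where the faces of $S_K$ that collapse to a single vertex when $S_K$ is shrunk to $K$ are called additional and the others dilated ($S_K$ is assumed to have $d+1$ dilated faces). $\Gamma(S_K,\cdot)$ is a linear bijection $P_1(S_K)\to\mathbb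 R^{d+1}$. Sampling space and form. For each $K$, $V_K\subset H^1(S_K)$ is a subspace and $s_K^\varepsilon:V_K\times V_K\to\mathbb R$ a bilinear form such that: $P_1(S_K)\subset V_K$; $\Gamma(S_K,\cdot)$ is well-defined on $V_K$; and, with $V_{K,0}=\{w\in V_K:\Gamma(S_K,w)=0\}$, for every $g\in(H^1(S_K))'$ and every prescribed value of $\Gamma(S_K,v)$ there is a unique $v\in V_K$ with $s_K^\varepsilon(v,w)=\langle g,w\rangle$ for all $w\in V_{K,0}$ and $\Gamma(S_K,v)$ equal to the prescribed value. Numerical correctors. The corrector equations for $\chi_{S_K}^\alpha\in V_K$ are: for all $w\in V_{K,0}$, $s_K^\varepsilon(\chi_{S_K}^0,w)=-s_K^\varepsilon(1,w)$ for $\alpha=0$, and $s_K^\varepsilon(\chi_{S_K}^\alpha,w)=-s_K^\varepsilon(x^\alpha-x^\alpha_{c,K},w)$ for $1\le\alpha\le d$. The DOF-extended corrector $\chi_{S_K}^{\alpha,\mathsf e}$ is the unique solution in $V_{K,0}$ (i.e. $\Gamma(S_K,\chi_{S_K}^{\alpha,\mathsf e})=0$). The DOF-continuous corrector $\chi_{S_K}^{\alpha,\mathsf c}$ is the unique solution in $V_K$ with $\Gamma(K,\chi_{S_K}^{\alpha,\mathsf c})=0$; when DOF-continuous correctors are used, $\Gamma(K,\cdot)$ is assumed well-defined on $V_K$ and the problem of finding $v\in V_K$ with $s_K^\varepsilon(v,w)=\langle g,w\rangle$ for all $w\in V_{K,0}$ and $\Gamma(K,v)$ prescribed is assumed well-posed.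 For $\bullet\in\{\mathsf e,\mathsf c\}$, $\chi_K^{\alpha,\bullet}$ is the restriction of $\chi_{S_K}^{\alpha,\bullet}$ to $K$, extended by $0$ to $\Omega$. Multiscale functions. For $1\le i\le N$, $\phi_i^\varepsilon|_K=\phi_i|_K+\phi_i|_K(x_{c,K})\chi_K^{0,\bullet}+\sum_{\alpha=1}^d\partial_\alpha(\phi_i|_K)\chi_K^{\alpha,\bullet}$ for all $K\in\mathcal T_H$. $V_{H,0}^\varepsilon=\mathrm{span}\{\phi_i^\varepsilon:1\le i\le N_0\}$. On $K$, set $W_K^0=1+\chi_K^{0,\bullet}$ and $W_K^\alpha=x^\alpha-x^\alpha_{c,K}+\chi_K^{\alpha,\bullet}$ for $1\le\alpha\le d$. *)

(* Defs.v *)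
From HB Require Import structures.
From mathcomp Require Import all_boot all_order all_algebra.
From mathcomp Require Import all_classical all_reals all_analysis.

Set Implicit Arguments.
Unset Strict Implicit.
Unset Printing Implicit Defensive.
Import Order.TTheory GRing.Theory Num.Theory.
Import numFieldNormedType.Exports.

Local Open Scope classical_set_scope.
Local Open Scope ring_scope.

(* The product (equivalently, Borel) sigma-algebra on R^n. *)
Definition measure_rV_display : measure_display.
Proof. exact. Qed.

Section measurable_rV.
Variables (R : realType) (n : nat).

Let coord (i : 'I_n) (v : 'rV[R]_n) : R := v ord0 i.

Let rV_set0 : g_sigma_preimage coord set0.
Proof. exact: sigma_algebra0. Qed.

Let rV_setC A : g_sigma_preimage coord A -> g_sigma_preimage coord (~` A).
Proof. exact: sigma_algebraC. Qed.

Let rV_bigcup (F : _^nat) : (forall i, g_sigma_preimage coord (F i)) ->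
  g_sigma_preimage coord (\bigcup_i (F i)).
Proof. exact: sigma_algebra_bigcup. Qed.

HB.instance Definition _ := @isMeasurable.Build measure_rV_display
  'rV[R]_n (g_sigma_preimage coord) rV_set0 rV_setC rV_bigcup.

Lemma measurable_coord (i : 'I_n) :
  measurable_fun [set: 'rV[R]_n] (fun v : 'rV[R]_n => v ord0 i).
Proof.
move=> _ Y mY; rewrite setTI; apply: sub_sigma_algebra => /=.
rewrite -bigcup_seq/=; exists i => /=; first by rewrite mem_index_enum.
by exists Y => //; rewrite setTI.
Qed.

Lemma measurable_fun_rV d (T : measurableType d) (f : T -> 'rV[R]_n) :
  (forall i, measurable_fun [set: T] (fun x => f x ord0 i)) ->
  measurable_fun [set: T] f.
Proof.
move=> mf.
have : g_sigma_preimage (fun i => coord i \o f) `<=` measurable.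
  apply: smallest_sub; first exact: sigma_algebra_measurable.
  rewrite -bigcup_seq => A [i _ [B mB <-]]; exact: mf.
rewrite g_sigma_preimage_comp => prefS _ A mA.
by apply: prefS; exists A.
Qed.

End measurable_rV.

Section rV_cons.
Variables (R : realType) (n : nat).

Definition rV_cons (p : R * 'rV[R]_n) : 'rV[R]_n.+1 :=
  \row_i oapp (p.2 ord0) p.1 (unlift ord0 i).

Definition rV_uncons (v : 'rV[R]_n.+1) : R * 'rV[R]_n :=
  (v ord0 ord0, \row_i v ord0 (lift ord0 i)).

Lemma rV_consK : cancel rV_cons rV_uncons.
Proof.
case=> a v; rewrite /rV_uncons /rV_cons !mxE unlift_none /=; congr pair.
by apply/rowP => i; rewrite !mxE liftK.
Qed.

Lemma measurable_rV_cons : measurable_fun setT rV_cons.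
Proof.
apply: measurable_fun_rV => i; rewrite /rV_cons.
under eq_fun do rewrite mxE.
case: unliftP => [j _|_] /=; last exact: measurable_fst.
exact: (measurableT_comp (measurable_coord j) measurable_snd).
Qed.

Lemma measurable_rV_uncons : measurable_fun setT rV_uncons.
Proof.
apply: measurable_fun_pair; first exact: measurable_coord.
apply: measurable_fun_rV => i; under eq_fun do rewrite mxE.
exact: measurable_coord.
Qed.

Variables (m : {sigma_finite_measure set 'rV[R]_n -> \bar R}).

Definition rV_step_measure : set 'rV[R]_n.+1 -> \bar R :=
  pushforward (lebesgue_measure \x m)%E rV_cons.

Let rV_step0 : rV_step_measure set0 = 0%E.
Proof. by rewrite /rV_step_measure /pushforward preimage_set0 measure0. Qed.

Let rV_step_ge0 A : (0 <= rV_step_measure A)%E.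
Proof. by rewrite /rV_step_measure /pushforward; exact: measure_ge0. Qed.

Let rV_step_sigma_additive : semi_sigma_additive rV_step_measure.
Proof.
move=> F mF tF mUF; rewrite /rV_step_measure /pushforward preimage_bigcup.
have mc (A : set 'rV[R]_n.+1) : measurable A -> measurable (rV_cons @^-1` A).
  by move=> mA; rewrite -[X in measurable X]setTI; exact: measurable_rV_cons.
apply: measure_semi_sigma_additive.
- by move=> k; exact: mc.
- apply/trivIsetP => /= i j _ _ ij; rewrite -preimage_setI.
  by move/trivIsetP : tF => /(_ _ _ _ _ ij) ->//; rewrite preimage_set0.
- by rewrite -preimage_bigcup; exact: mc.
Qed.

HB.instance Definition _ := isMeasure.Build _ _ _ rV_step_measure
  rV_step0 rV_step_ge0 rV_step_sigma_additive.

Let rV_step_sigma_finite : sigma_finite setT rV_step_measure.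
Proof.
have /sigma_finiteP[F [TF ndF Foo]] := sigma_finiteT (@lebesgue_measure R).
have /sigma_finiteP[G [TG ndG Goo]] := sigma_finiteT m.
exists (fun k => rV_uncons @^-1` (F k `*` G k)).
  rewrite -preimage_bigcup -[LHS](@preimage_setT _ _ rV_uncons); congr preimage.
  rewrite -setXTT TF TG predeqE => -[x y]; split.
    move=> [/= [k _ Fkx] [l _ Gly]]; exists (maxn k l) => //; split.
    - by move: x Fkx; exact/subsetPset/ndF/leq_maxl.
    - by move: y Gly; exact/subsetPset/ndG/leq_maxr.
  by move=> [k _ []/= ? ?]; split; exists k.
move=> k; have [mFk Fkoo] := Foo k; have [mGk Gkoo] := Goo k.
split.
  rewrite -[X in measurable X]setTI; apply: measurable_rV_uncons => //.
  exact: measurableX.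
rewrite /rV_step_measure /pushforward -comp_preimage.
rewrite (_ : rV_uncons \o rV_cons = id); last first.
  by rewrite funeqE => x /=; exact: rV_consK.
by rewrite preimage_id product_measure1E// lte_mul_pinfty// ge0_fin_numE.
Qed.

HB.instance Definition _ := Measure_isSigmaFinite.Build _ _ _ rV_step_measure
  rV_step_sigma_finite.

End rV_cons.

Fixpoint lebesgue_rV (R : realType) (n : nat) :
    {sigma_finite_measure set 'rV[R]_n -> \bar R} :=
  if n is k.+1 then [the {sigma_finite_measure set _ -> \bar R} of
                       rV_step_measure (lebesgue_rV R k)]
  else [the {sigma_finite_measure set 'rV[R]_0 -> \bar R} of \d_(0 : 'rV[R]_0)].

Lemma lebesgue_rV_box (R : realType) n (A : 'I_n -> set R) :
  (forall i, measurable (A i)) ->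
  lebesgue_rV R n [set v | forall i, A i (v ord0 i)] =
  (\prod_(i < n) lebesgue_measure (A i))%E.
Proof.
elim: n => [|n IH] in A *; move=> mA.
  rewrite big_ord0 /= diracE mem_set //; by case.
rewrite big_ord_recl -IH; last by move=> i; exact: mA.
rewrite /= /rV_step_measure /pushforward.
rewrite -product_measure1E //; [|exact: (mA ord0)|].
  congr ((lebesgue_measure \x lebesgue_rV R n)%E _).
  rewrite predeqE => -[x v] /=; split=> [h|[hx hv] i].
    split=> [|i]; first by have := h ord0; rewrite mxE unlift_none.
    by have := h (lift ord0 i); rewrite mxE liftK.
  by rewrite mxE; case: unliftP => [j ->|->] /=.
set B := (X in measurable X).
have -> : B = \big[setI/setT]_(i < n)
    ((fun v : 'rV[R]_n => v ord0 i) @^-1` A (lift ord0 i)).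
  rewrite predeqE => v; rewrite -bigcap_seq /B /bigcap /=.
  split=> [h i _|h i]; first exact: h.
  by apply: h; rewrite mem_index_enum.
apply: bigsetI_measurable => i _; rewrite -[X in measurable X]setTI.
by apply: measurable_coord => //; exact: mA.
Qed.

(* Functions on subsets of R^d are represented by total functions on 'rV[R]_d; *)
(* elements of L^2 and H^1 are thus representatives of a.e. classes.           *)
Section sobolev.
Variables (R : realType) (d : nat).
Local Notation V := 'rV[R]_d.
Local Notation mu := (lebesgue_rV R d).

Definition partial (k : 'I_d) (f : V -> R) (x : V) : R :=
  'D_(delta_mx ord0 k) f x.

Definition iter_partial (s : seq 'I_d) (f : V -> R) : V -> R :=
  foldr partial f s.

Definition smooth (f : V -> R) := forall s : seq 'I_d,
  continuous (iter_partial s f) /\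
  forall (k : 'I_d) (x : V), derivable (iter_partial s f) x (delta_mx ord0 k).

Definition test_function (U : set V) (f : V -> R) :=
  let supp := closure [set x | f x != 0] in
  [/\ smooth f, compact supp & supp `<=` U].

Definition L2 (D : set V) (u : V -> R) :=
  measurable_fun D u /\ (\int[mu]_(x in D) ((u x) ^+ 2)%:E < +oo)%E.

Definition sqL2norm (D : set V) (u : V -> R) : R :=
  \int[mu]_(x in D) (u x) ^+ 2.

Definition weak_gradient (U : set V) (u : V -> R) (g : 'I_d -> V -> R) :=
  forall k, L2 U (g k) /\
    forall f, test_function U f ->
      \int[mu]_(x in U) (u x * partial k f x) =
      - \int[mu]_(x in U) (g k x * f x).

(* H^1 of a closed (polytopal) set S is H^1 of its interior. *)
Definition H1 (S : set V) : set (V -> R) :=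
  [set u | L2 S° u /\ exists g, weak_gradient S° u g].

(* A weak gradient g of u is an explicit argument: it is unique up to null     *)
(* sets, so that the norms below depend only on u.                             *)
Definition sqgradnorm (S : set V) (g : 'I_d -> V -> R) : R :=
  \sum_k sqL2norm S° (g k).

Definition H1norm (S : set V) (u : V -> R) (g : 'I_d -> V -> R) : R :=
  Num.sqrt (sqL2norm S° u + sqgradnorm S g).

Definition H10 (S : set V) : set (V -> R) :=
  [set u | H1 S u /\ forall e, 0 < e -> exists f g,
     [/\ test_function S° f, weak_gradient S° (u - f) g
       & H1norm S (u - f) g < e]].

Definition eq_on_ae (S : set V) (u v : V -> R) := ae_eq mu S° u v.

Definition linear_on (W : lmodType R) (X : set (V -> R)) (l : (V -> R) -> W) :=
  forall (c : R) u v, X u -> X v -> l (c *: u + v) = c *: l u + l v.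

Definition bilinear_on (X : set (V -> R)) (a : (V -> R) -> (V -> R) -> R) :=
  forall w, X w -> linear_on (W := R^o) X (a w) /\
                   linear_on (W := R^o) X (fun u => a u w).

Definition continuous_form (S : set V) (a : (V -> R) -> (V -> R) -> R) :=
  exists C : R, forall u v g h,
    H1 S u -> H1 S v -> weak_gradient S° u g -> weak_gradient S° v h ->
    `|a u v| <= C * (H1norm S u g * H1norm S v h).

Definition coercive_H10 (S : set V) (a : (V -> R) -> (V -> R) -> R) :=
  exists2 c : R, 0 < c & forall u g,
    H10 S u -> weak_gradient S° u g -> c * H1norm S u g ^+ 2 <= a u u.

Definition gradient_coercive (S : set V) (a : (V -> R) -> (V -> R) -> R) :=
  exists2 c : R, 0 < c & forall u g,
    H1 S u -> weak_gradient S° u g -> c * sqgradnorm S g <= a u u.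

Definition H1_dual (S : set V) (l : (V -> R) -> R) :=
  linear_on (W := R^o) (H1 S) l /\
  exists C : R, forall u g,
    H1 S u -> weak_gradient S° u g -> `|l u| <= C * H1norm S u g.

Definition affine (p : V -> R) :=
  exists (b : R) (c : 'I_d -> R), forall x : V, p x = b + \sum_k c k * x ord0 k.

End sobolev.

Section geometry.
Variables (R : realType) (d : nat).
Local Notation V := 'rV[R]_d.

Definition convex_weights n (l : 'I_n -> R) :=
  (forall i, 0 <= l i) /\ \sum_i l i = 1.

Definition conv_hull n (p : 'I_n -> V) : set V :=
  [set x | exists2 l, convex_weights l & x = \sum_i l i *: p i].

(* Closed, not necessarily convex, polytopes. *)
Definition polytope (A : set V) :=
  A !=set0 /\ exists (m : nat) (n : 'I_m -> nat) (p : forall j, 'I_(n j) -> V),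
    (forall j, (conv_hull (p j))° !=set0) /\
    A = \bigcup_(j in [set: 'I_m]) conv_hull (p j).

Definition boundary (A : set V) : set V := closure A `\` A°.

Definition nondegenerate (p : 'I_d.+1 -> V) :=
  row_free (\matrix_(i < d) (p (lift ord0 i) - p ord0)).

Definition subsimplex (p : 'I_d.+1 -> V) (J : {set 'I_d.+1}) : set V :=
  [set x | exists l, [/\ convex_weights l, forall i, i \notin J -> l i = 0
                       & x = \sum_i l i *: p i]].

Definition face (p : 'I_d.+1 -> V) (i : 'I_d.+1) : set V :=
  subsimplex p [set~ i].

Definition centroid (p : 'I_d.+1 -> V) : V := d.+1%:R^-1 *: \sum_i p i.

Definition volume (A : set V) : R := fine (lebesgue_rV R d A).

(* Integrals over a flat (d-1)-dimensional set F are computed in an            *)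
(* orthonormal parametrization y |-> o + y B of a hyperplane containing F.     *)
Definition chart (oB : V * 'M[R]_(d.-1, d)) (y : 'rV[R]_d.-1) : V :=
  oB.1 + y *m oB.2.

Definition face_chart (F : set V) : V * 'M[R]_(d.-1, d) :=
  get [set oB | oB.2 *m oB.2^T = 1%:M /\ F `<=` range (chart oB)].

Definition surface_integral (F : set V) (v : V -> R) : R :=
  \int[lebesgue_rV R d.-1]_(y in chart (face_chart F) @^-1` F)
    v (chart (face_chart F) y).

Definition average (F : set V) (v : V -> R) : R :=
  surface_integral F v / surface_integral F (fun=> 1).

(* A vertex of a polytope is a point around which it is not invariant by       *)
(* translation in any direction. For convex polytopes these are the extreme    *)
(* points.                                                                     *)
Definition vertex_of (S : set V) (x : V) :=
  S x /\ forall u : V, u != 0 -> ~ exists2 e : R, 0 < e &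
    forall (y : V) (t : R), ball x e y -> `|t| < e -> (S y <-> S (y + t *: u)).

(* Each connected component consists of the interior points of one facet; this *)
(* also makes sense for non-convex S.                                          *)
Definition flat_boundary (S : set V) : set V :=
  [set x | exists2 n : V, n != 0 & exists2 e : R, 0 < e &
     forall y, ball x e y -> (S y <-> ((y - x) *m n^T) ord0 ord0 <= 0)].

Definition facet_of (S F : set V) :=
  exists2 x, flat_boundary S x &
    F = closure (connected_component (flat_boundary S) x).

Definition homothety (c : V) (r : R) (x : V) : V := c + r *: (x - c).

Definition oversampling_patch (Omega : set V) (p : 'I_d.+1 -> V) (r : R) :
  set V := (homothety (centroid p) r @` conv_hull p) `&` Omega.

(* Shrinking the patch to K by decreasing the homothety ratio to 1 leaves      *)
(* F `&` K of a facet F carried by the boundary of Omega; facets carried by    *)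
(* the boundary of the dilated simplex shrink to the faces of K. In dimension  *)
(* 1 facets are points and nothing collapses.                                  *)
Definition additional_face (p : 'I_d.+1 -> V) (F : set V) :=
  (forall x, F <> [set x]) /\ exists i, F `&` conv_hull p = [set p i].

Definition dilated_face (p : 'I_d.+1 -> V) (S F : set V) :=
  facet_of S F /\ ~ additional_face p F.

Record mesh (Omega : set V) := Mesh {
  elt : finType ;
  vtx : elt -> 'I_d.+1 -> V ;
  mesh_nondegenerate : forall K, nondegenerate (vtx K) ;
  mesh_conformal : forall K L, K != L -> exists I J : {set 'I_d.+1},
    [/\ I != [set: 'I_d.+1]%SET, J != [set: 'I_d.+1]%SET,
        conv_hull (vtx K) `&` conv_hull (vtx L) = subsimplex (vtx K) I
      & conv_hull (vtx K) `&` conv_hull (vtx L) = subsimplex (vtx L) J] ;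
  mesh_cover : Omega = \bigcup_(K in [set: elt]) conv_hull (vtx K) }.

Definition cell (Omega : set V) (T : mesh Omega) (K : elt T) : set V :=
  conv_hull (vtx K).

End geometry.

Variant msfem := MsFEM_lin | MsFEM_CR.

Variant dof_variant := DOF_extended | DOF_continuous.

Section degrees_of_freedom.
Variables (R : realType) (d : nat).
Local Notation V := 'rV[R]_d.

Variant dof_site := Pt of V | Fc of set V.

Definition dof_value (s : dof_site) (v : V -> R) : R :=
  match s with Pt x => v x | Fc F => average F v end.

Definition site_in (s : dof_site) (A : set V) : Prop :=
  match s with Pt x => A x | Fc F => F `<=` A end.

Definition dof_op (s : 'I_d.+1 -> dof_site) (v : V -> R) : 'rV[R]_d.+1 :=
  \row_i dof_value (s i) v.

Definition simplex_sites (ty : msfem) (p : 'I_d.+1 -> V) (i : 'I_d.+1) :=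
  match ty with MsFEM_lin => Pt (p i) | MsFEM_CR => Fc (face p i) end.

Definition patch_sites (ty : msfem) (p : 'I_d.+1 -> V) (S : set V)
    (s : 'I_d.+1 -> dof_site) : Prop :=
  injective s /\
  match ty with
  | MsFEM_lin => forall i, exists2 x, vertex_of S x & s i = Pt x
  | MsFEM_CR => range s = @Fc @` dilated_face p S
  end.

Definition dof_bijective (s : 'I_d.+1 -> dof_site) :=
  linear_on (@affine R d) (dof_op s) /\
  forall c, exists! v, affine v /\ dof_op s v = c.

(* "Gamma is well defined on X" : a linear extension of the DOF operator from  *)
(* the affine functions to X, which depends only on the a.e. class on S.       *)
Definition dof_extension (S : set V) (s : 'I_d.+1 -> dof_site)
    (X : set (V -> R)) (G : (V -> R) -> 'rV[R]_d.+1) :=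
  [/\ linear_on X G,
      forall u v, X u -> X v -> eq_on_ae S u v -> G u = G v
    & forall v, affine v -> G v = dof_op s v].

Variables (Omega : set V) (T : mesh Omega) (ty : msfem).

(* A function in P_1(T) is given by its restrictions to the elements, each     *)
(* being extended to an affine function on R^d.                                *)
Definition VH : set (elt T -> V -> R) :=
  [set v | (forall K, affine (v K)) /\
    match ty with
    | MsFEM_lin => exists2 f : V -> R, {within Omega, continuous f} &
        forall K x, cell K x -> f x = v K x
    | MsFEM_CR => forall K L i j, K != L -> face (vtx K) i = face (vtx L) j ->
        surface_integral (face (vtx K) i) (v K - v L) = 0
    end].

Definition VH0 : set (elt T -> V -> R) :=
  [set v | VH v /\ forall K i,
    site_in (simplex_sites ty (vtx K) i) (boundary Omega) ->
    dof_op (simplex_sites ty (vtx K)) (v K) ord0 i = 0].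

Definition is_basis (X : set (elt T -> V -> R)) n (b : 'I_n -> elt T -> V -> R) :=
  (forall i, X (b i)) /\
  forall v, X v -> exists! c : 'rV[R]_n,
    forall K x, v K x = \sum_i c ord0 i * b i K x.

Definition dual_to_sites n (b : 'I_n -> elt T -> V -> R) :=
  exists s : 'I_n -> dof_site,
    [/\ injective s,
        range s =
          [set t | exists (K : elt T) i, t = simplex_sites ty (vtx K) i]
      & forall i j K k, s j = simplex_sites ty (vtx K) k ->
          dof_op (simplex_sites ty (vtx K)) (b i K) ord0 k = (i == j)%:R].

End degrees_of_freedom.

Section sampling.
Variables (R : realType) (d : nat).
Local Notation V := 'rV[R]_d.
Variables (S : set V) (X : set (V -> R)).
Variables (s : (V -> R) -> (V -> R) -> R) (G : (V -> R) -> 'rV[R]_d.+1).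

(* Linear subspaces of H^1(S), as sets of representatives. *)
Definition H1_subspace :=
  [/\ X `<=` H1 S, X 0, forall (c : R) u v, X u -> X v -> X (c *: u + v)
    & forall u v, X u -> H1 S v -> eq_on_ae S u v -> X v].

Definition form_on_classes :=
  bilinear_on X s /\
  forall u u' v v', X u -> X u' -> X v -> X v' ->
    eq_on_ae S u u' -> eq_on_ae S v v' -> s u v = s u' v'.

Definition kernel_space : set (V -> R) := [set w | X w /\ G w = 0].

Definition well_posed (G' : (V -> R) -> 'rV[R]_d.+1) :=
  forall g, H1_dual S g -> forall c : 'rV[R]_d.+1,
    let solution v :=
      [/\ X v, forall w, kernel_space w -> s v w = g w & G' v = c] in
    exists2 v, solution v & forall v', solution v' -> eq_on_ae S v v'.

End sampling.

(* Correctors are indexed by option 'I_d: None stands for the index 0, and     *)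
(* Some k for the k-th coordinate direction.                                   *)
Section effective.
Variables (R : realType) (d : nat).
Local Notation V := 'rV[R]_d.
Variables (p : 'I_d.+1 -> V).
Local Notation K := (conv_hull p).
Local Notation xc := (centroid p).

Definition affine_mode (k : option 'I_d) : V -> R :=
  if k is Some i then fun x => x ord0 i - xc ord0 i else fun=> 1.

Definition corrector_equation (X0 : set (V -> R))
    (s : (V -> R) -> (V -> R) -> R) (k : option 'I_d) (chi : V -> R) :=
  forall w, X0 w -> s chi w = - s (affine_mode k) w.

Definition extend0 (A : set V) (u : V -> R) : V -> R :=
  fun x => if x \in A then u x else 0.

Variables (a : (V -> R) -> (V -> R) -> R) (chi : option 'I_d -> V -> R).

Definition multiscale (v : V -> R) : V -> R := fun x =>
  v x + v xc * chi None x + \sum_k partial k v x * chi (Some k) x.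

Definition multiscale_mode (k : option 'I_d) : V -> R :=
  affine_mode k + chi k.
Local Notation W := multiscale_mode.

Definition effM : R :=
  (volume K)^-1 * (a (W None) (affine_mode None) + a (W None) (chi None)).

Definition effB1 (k : 'I_d) : R :=
  (volume K)^-1 *
    (a (W (Some k)) (affine_mode None) + a (W (Some k)) (chi None)).

Definition effB2 (l : 'I_d) : R :=
  (volume K)^-1 *
    (a (W None) (affine_mode (Some l)) + a (W None) (chi (Some l))).

Definition effA (l k : 'I_d) : R :=
  (volume K)^-1 *
    (a (W (Some k)) (affine_mode (Some l)) + a (W (Some k)) (chi (Some l))).

Definition effective_integrand (u v : V -> R) (x : V) : R :=
  \sum_l partial l v x * (\sum_k effA l k * partial k u x)
  + v x * (\sum_k effB1 k * partial k u x)
  + u x * (\sum_l effB2 l * partial l v x)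
  + effM * u x * v x.

(* Q evaluates the integral over K: exactly, or by a quadrature rule. *)
Definition effective_form (Q : (V -> R) -> R) (u v : V -> R) : R :=
  Q (effective_integrand u v).

Definition exact_integral (g : V -> R) : R :=
  \int[lebesgue_rV R d]_(x in K) g x.

Definition one_point_rule (g : V -> R) : R := volume K * g xc.

End effective.

(* Main.v *)
Require Import Defs.
From HB Require Import structures.
From mathcomp Require Import all_boot all_order all_algebra.
From mathcomp Require Import all_classical all_reals all_analysis.
From mathcomp Require Import measurable_realfun ring.

Set Implicit Arguments.
Unset Strict Implicit.
Unset Printing Implicit Defensive.
Import Order.TTheory GRing.Theory Num.Theory.
Import numFieldNormedType.Exports.

Local Open Scope classical_set_scope.
Local Open Scope ring_scope.

(** On an element K, an affine function v is its value at the centroid plus the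
    sum of its partial derivatives times the centred coordinates. The multiscale
    function built from v therefore is the combination, with the same
    coefficients, of the modes W^0, ..., W^d obtained by adding the correctors to
    1 and to the centred coordinates (multiscaleE). Expanding a_K by bilinearity
    gives a double sum of products of such coefficients with the numbers
    a_K(W^k, W^l); these numbers are the effective coefficients times |K|, and the
    products are the values at the centroid of the products of u, v and their
    derivatives in the effective integrand. Hence the equality holds on each
    element (one_point_effective_form).

    Two facts remain to be justified. The factor |K| must cancel with its inverse,
    which requires that a nondegenerate simplex has positive and finite measure
    (volume_simplex_gt0); this is seen from its barycentric coordinates. And a_K is
    bilinear only on H^1(K), so that all functions involved must belong to that
    space: they coincide on K with functions of the sampling space V_K, contained
    in H^1(S_K), and H^1 functions on the patch S_K restrict to H^1 functions on K
    (H1_restrict, sub_oversampling_patch). *)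

(** * Boxes and open sets are measurable *)

Section measurable_boxes.
Variables (R : realType) (n : nat).
Local Notation V := 'rV[R]_n.

Lemma measurable_rV_box (A : 'I_n -> set R) : (forall i, measurable (A i)) ->
  measurable [set v : V | forall i, A i (v ord0 i)].
Proof.
move=> mA.
rewrite (_ : [set _ | _] = \big[setI/setT]_(i < n)
    ((fun v : V => v ord0 i) @^-1` A i)).
  apply: bigsetI_measurable => i _; rewrite -[X in measurable X]setTI.
  exact: measurable_coord.
rewrite -bigcap_seq predeqE => v; split=> [h i _|h i]; first exact: h.
by apply: (h i); rewrite /= mem_index_enum.
Qed.

Lemma ball_rV (x : V) (e : R) : 0 < e ->
  ball x e = [set y | forall i, [set` `]x ord0 i - e, x ord0 i + e[] (y ord0 i)].
Proof.
move=> e0; rewrite predeqE => y; split=> [[_ h] i|h].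
  by have := h ord0 i; rewrite /ball /= ltr_distlC in_itv /=.
split=> // i j; rewrite (ord1 i); have := h j.
by rewrite /ball /= ltr_distlC /= in_itv /=.
Qed.

(** The sigma-algebra of 'rV[R]_n is generated by the coordinates, so that it is
    not by definition the Borel one; but an open set is the union of the
    countably many boxes with rational corners that it contains. *)
Lemma open_measurable_rV (U : set V) : open U -> measurable U.
Proof.
move=> oU.
pose box (q : 'rV[rat]_n * 'rV[rat]_n) : set V :=
  [set y | forall i, [set` `]ratr (q.1 ord0 i), ratr (q.2 ord0 i)[] (y ord0 i)].
rewrite (_ : U = \bigcup_(q in [set q | box q `<=` U]) box q).
  rewrite bigcup_mkcond; apply: countable_bigcupT_measurable => [|q].
    exact: countableP.
  case: ifP => // _; apply: (@measurable_rV_box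
    (fun i => [set` `]ratr (q.1 ord0 i), ratr (q.2 ord0 i)[])) => i;
    exact: measurable_itv.
rewrite predeqE => x; split=> [Ux|[q qU] /qU //].
have /nbhs_ballP[e /= e0 xeU] : nbhs x U by exact: open_nbhs_nbhs.
have /choice[a ha] : forall i, exists q : rat, ratr q \in `]x ord0 i - e, x ord0 i[.
  by move=> i; apply: rat_in_itvoo; rewrite ltrBlDr ltrDl.
have /choice[b hb] : forall i, exists q : rat, ratr q \in `]x ord0 i, x ord0 i + e[.
  by move=> i; apply: rat_in_itvoo; rewrite ltrDl.
exists (\row_i a i, \row_i b i) => /=.
  move=> y hy; apply: xeU; rewrite ball_rV// => i.
  have := hy i; rewrite /= !mxE !in_itv /= => /andP[ay yb].
  have := ha i; have := hb i; rewrite !in_itv /= => /andP[_ be] /andP[ae _].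
  by rewrite (lt_trans ae ay) (lt_trans yb be).
move=> i /=; rewrite !mxE in_itv /=.
have := ha i; have := hb i; rewrite !in_itv /= => /andP[-> _] /andP[_ ->] //.
Qed.

End measurable_boxes.

(** * Restriction of H1 functions to a smaller set *)

Section restriction.
Variables (R : realType) (d : nat).
Local Notation V := 'rV[R]_d.
Local Notation mu := (lebesgue_rV R d).

Lemma L2_restrict (A B : set V) (u v : V -> R) : open A -> open B ->
  A `<=` B -> (forall x, A x -> u x = v x) -> L2 B v -> L2 A u.
Proof.
move=> oA oB AB uv [mv iv].
have mA := open_measurable_rV oA; have mB := open_measurable_rV oB.
split.
  apply: (@eq_measurable_fun _ _ _ _ A v); last exact: measurable_funS mv.
  by move=> x /set_mem /uv.
apply: le_lt_trans iv.
rewrite (eq_integral (fun x => (v x ^+ 2)%:E)); last first.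
  by move=> x /set_mem /uv ->.
apply: ge0_subset_integral => //.
  by apply/measurable_EFinP; apply: measurable_funX.
by move=> x _; rewrite lee_fin sqr_ge0.
Qed.

(** Every point outside U has a neighbourhood disjoint from the support, on which
    f is identically zero. *)
Lemma test_function_outside (U : set V) (f : V -> R) x : test_function U f ->
  ~ U x -> f x = 0 /\ forall k, partial k f x = 0.
Proof.
move=> [_ _ sU] nUx.
have nsx : ~ closure [set x | f x != 0] x by move/sU.
have fx0 : \near x, f x = (cst 0 : V -> R) x.
  have : nbhs x (~` closure [set x | f x != 0]).
    by apply: open_nbhs_nbhs; split=> //; apply: closed_openC; exact: closed_closure.
  apply: filterS => y /= nsy; apply/eqP/negPn/negP => fy; apply: nsy.
  exact: subset_closure.
split; first exact: nbhs_singleton fx0.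
move=> k; rewrite /partial (near_eq_derive _ fx0).
exact: derive_cst.
Qed.

Lemma test_functionS (A B : set V) (f : V -> R) : A `<=` B ->
  test_function A f -> test_function B f.
Proof. by move=> AB [sf cf fA]; split=> // x /fA /AB. Qed.

Lemma Rintegral_restrict (A B : set V) (u v : V -> R) : A `<=` B ->
  (forall x, A x -> u x = v x) -> (forall x, ~ A x -> v x = 0) ->
  \int[mu]_(x in A) u x = \int[mu]_(x in B) v x.
Proof.
move=> AB uv v0; rewrite Rintegral_mkcond [RHS]Rintegral_mkcond.
congr (Rintegral _ _ _); apply/funext => x; rewrite !patchE.
have [/set_mem Ax|/negP nAx] := boolP (x \in A).
  by rewrite mem_set ?uv //; exact: AB.
rewrite (v0 x) ?if_same //; apply: contra_not nAx; exact: mem_set.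
Qed.

(** A test function on A is one on B, and both integrands of the defining
    identity vanish outside A: the identity on A is an instance of the one on B,
    with the same gradient. *)
Lemma weak_gradient_restrict (A B : set V) (u v : V -> R) (g : 'I_d -> V -> R) :
  open A -> open B -> A `<=` B -> (forall x, A x -> u x = v x) ->
  weak_gradient B v g -> weak_gradient A u g.
Proof.
move=> oA oB AB uv wg k; have [Lg ig] := wg k.
split=> [|f tf]; first exact: L2_restrict Lg.
have tf0 x : ~ A x -> f x = 0 /\ partial k f x = 0.
  by move=> /(test_function_outside tf)[-> /(_ k)->].
rewrite (@Rintegral_restrict A B _ (fun x => v x * partial k f x)) //.
- rewrite ig; last exact: test_functionS tf.
  congr (- _); apply/esym/Rintegral_restrict => // x /tf0[-> _].
  by rewrite mulr0.
- by move=> x /uv ->.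
- by move=> x /tf0[_ ->]; rewrite mulr0.
Qed.

Lemma H1_restrict (A B : set V) (u v : V -> R) : A `<=` B ->
  (forall x, A x -> u x = v x) -> H1 B v -> H1 A u.
Proof.
move=> AB uv [Lv [g wg]].
have ABi := interiorS AB.
have uvi x : A° x -> u x = v x by move=> /interior_subset /uv.
split; first exact: L2_restrict (@open_interior _ A) (@open_interior _ B) ABi uvi Lv.
by exists g; apply: weak_gradient_restrict ABi uvi wg; exact: open_interior.
Qed.

End restriction.

(** * Affine functions *)

Section affine_functions.
Variables (R : realType) (d : nat).
Local Notation V := 'rV[R]_d.

Lemma partial_affine (b : R) (c : 'I_d -> R) (k : 'I_d) (x : V) :
  partial k (fun x => b + \sum_i c i * x ord0 i) x = c k.
Proof.
rewrite /partial /derive; apply: lim_near_cst => //.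
near=> h.
have h0 : h != 0 by near: h; exact: nbhs_dnbhs_neq.
rewrite /= /shift /= opprD addrACA subrr add0r -sumrB (bigD1 k) //= big1.
  rewrite addr0 !mxE !eqxx mulr1 -mulrBr addrK.
  by rewrite /GRing.scale /= mulrCA mulVf ?mulr1.
move=> i ik; rewrite !mxE eqxx (negbTE ik) mulr0 add0r subrr //.
Unshelve. all: by end_near. Qed.

Lemma affine_taylor (v : V -> R) : affine v -> forall x y : V,
  v x = v y + \sum_k partial k v y * (x ord0 k - y ord0 k).
Proof.
move=> [b [c vE]] x y; have -> : v = fun x => b + \sum_i c i * x ord0 i.
  exact/funext.
rewrite [X in _ = _ + X](eq_bigr (fun k => c k * x ord0 k - c k * y ord0 k)).
  by rewrite sumrB -addrA; congr (b + _); rewrite addrCA subrr addr0.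
by move=> k _; rewrite partial_affine mulrBr.
Qed.

Lemma affine_partial_cst (v : V -> R) : affine v -> forall k (x y : V),
  partial k v x = partial k v y.
Proof.
move=> [b [c vE]] k x y; have -> : v = fun x => b + \sum_i c i * x ord0 i.
  exact/funext.
by rewrite !partial_affine.
Qed.

Lemma affine_continuous (v : V -> R) : affine v -> continuous v.
Proof.
move=> [b [c vE]]; have -> : v = fun x => b + \sum_i c i * x ord0 i.
  exact/funext.
suff cs (r : seq 'I_d) : continuous (fun x : V => \sum_(i <- r) c i * x ord0 i).
  by move=> x; exact: (cvgD (cvg_cst b) (cs _ x)).
move=> x; elim: r => [|i r IHr].
  by under eq_fun do rewrite big_nil; exact: cst_continuous.
under eq_fun do rewrite big_cons.
apply: (@continuousD _ _ _ (fun y : V => c i * y ord0 i) _ x _ IHr).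
apply: (@continuousM _ _ (fun=> c i) (fun y : V => y ord0 i)).
  exact: cst_continuous.
exact: coord_continuous.
Qed.

End affine_functions.

(** * The volume of a nondegenerate simplex *)

Section simplex.
Variables (R : realType) (d : nat).
Local Notation V := 'rV[R]_d.
Variables (p : 'I_d.+1 -> V) (p_nd : Defs.nondegenerate p).

Let edges : 'M[R]_d := \matrix_(i < d) (p (lift ord0 i) - p ord0).

Let edges_unit : edges \in unitmx.
Proof. by rewrite -row_free_unit. Qed.

(** As the edges issued from p ord0 form a basis, the coordinates of x - p ord0
    on them are the barycentric coordinates of x of index different from ord0;
    the remaining one is fixed by the total sum 1. *)
Definition barycentric (x : V) (i : 'I_d.+1) : R :=
  let y := (x - p ord0) *m invmx edges in
  if unlift ord0 i is Some j then y ord0 j else 1 - \sum_j y ord0 j.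

Lemma barycentric_sum x : \sum_i barycentric x i = 1.
Proof.
rewrite big_ord_recl /barycentric unlift_none.
by under [X in _ + X]eq_bigr do rewrite liftK; rewrite subrK.
Qed.

Let edge_combination (l : 'I_d.+1 -> R) : \sum_i l i = 1 ->
  \sum_i l i *: p i - p ord0 = (\row_j l (lift ord0 j)) *m edges.
Proof.
move=> l1; rewrite -[X in _ - X]scale1r -l1 scaler_suml -sumrB.
rewrite mulmx_sum_row big_ord_recl subrr add0r.
by apply: eq_bigr => i _; rewrite mxE rowK scalerBr.
Qed.

Lemma barycentricK x : \sum_i barycentric x i *: p i = x.
Proof.
apply: (@addIr _ (- p ord0)); rewrite edge_combination ?barycentric_sum //.
rewrite -[RHS](mulmxKV edges_unit); congr (_ *m _).
by apply/rowP => j; rewrite mxE /barycentric liftK.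
Qed.

Lemma barycentric_unique (l : 'I_d.+1 -> R) x : \sum_i l i = 1 ->
  x = \sum_i l i *: p i -> forall i, barycentric x i = l i.
Proof.
move=> l1 ->  i; rewrite /barycentric edge_combination // mulmxK //.
case: unliftP => [j ->|->]; first by rewrite mxE.
rewrite -l1 big_ord_recl; under [X in _ - X]eq_bigr do rewrite mxE.
by rewrite addrK.
Qed.

Lemma conv_hullE : conv_hull p = [set x | forall i, 0 <= barycentric x i].
Proof.
rewrite predeqE => x; split=> [[l [l0 l1] xE] i|x0].
  by rewrite (barycentric_unique l1 xE).
exists (barycentric x); last by rewrite barycentricK.
by split=> //; exact: barycentric_sum.
Qed.

Lemma barycentric_centroid i : barycentric (centroid p) i = d.+1%:R^-1.
Proof.
apply: barycentric_unique; last by rewrite /centroid scaler_sumr.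
by rewrite sumr_const card_ord -[_ *+ _]mulr_natr mulVf.
Qed.

Lemma barycentric_continuous i : continuous (barycentric ^~ i).
Proof.
have aff j : affine (fun x : V => ((x - p ord0) *m invmx edges) ord0 j).
  exists (- (p ord0 *m invmx edges) ord0 j), (fun k => invmx edges k j) => x.
  rewrite mulmxBl !mxE addrC; congr (_ + _).
  by apply: eq_bigr => k _; rewrite mulrC.
apply: affine_continuous; rewrite /barycentric.
case: unliftP => [j _|_]; first exact: aff.
have /choice[b /choice[c bc]] := aff.
exists (1 - \sum_j b j), (fun k => - \sum_j c j k) => x.
under eq_bigr do rewrite bc.
rewrite big_split /= opprD addrA; congr (_ + _).
rewrite exchange_big /= -sumrN; apply: eq_bigr => k _.
by rewrite -mulr_suml mulNr.
Qed.

(** The simplex is closed: it is cut out by weak inequalities between continuous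
    functions, the barycentric coordinates being affine. *)
Lemma measurable_simplex : measurable (conv_hull p).
Proof.
rewrite conv_hullE -[X in measurable X]setCK; apply: measurableC.
apply: open_measurable_rV; rewrite openC.
rewrite (_ : [set _ | _] =
    \bigcap_(i in [set: 'I_d.+1]) ((barycentric ^~ i) @^-1` [set r | 0 <= r])).
  apply: closed_bigI => i _; apply: closed_comp; last exact: closed_ge.
  by move=> x _; exact: barycentric_continuous.
by rewrite predeqE => x; split=> [h i _|h i]; [exact: h|exact: (h i I)].
Qed.

(** All barycentric coordinates of the centroid equal 1 / (d + 1), and they remain
    positive nearby by continuity. *)
Lemma ball_centroid : exists2 e : R, 0 < e & ball (centroid p) e `<=` conv_hull p.
Proof.
suff /nbhs_ballP[e /= e0 h] : nbhs (centroid p) (conv_hull p) by exists e.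
rewrite conv_hullE.
have near_pos i : \forall x \near centroid p, 0 < barycentric x i.
  apply: (@barycentric_continuous i (centroid p) [set r | 0 < r]).
  apply: open_nbhs_nbhs; split; first exact: open_gt.
  by rewrite /= barycentric_centroid invr_gt0.
by apply: filterS (filter_forall _ near_pos) => x h i; exact: ltW.
Qed.

Lemma simplex_bounded : exists2 r : R, 0 < r & conv_hull p `<=`
  [set x | forall i, [set` `[- r, r]] (x ord0 i)].
Proof.
pose r := 1 + \sum_i \sum_j `|p i ord0 j|.
have r0 : 0 < r by apply: ltr_pwDl => //; apply: sumr_ge0 => i _; exact: sumr_ge0.
exists r => // x [l [l0 l1] ->] j /=; rewrite in_itv /= -ler_norml summxE.
apply: le_trans (ler_norm_sum _ _ _) _; rewrite -[leLHS]add0r lerD //.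
apply: ler_sum => i _; rewrite mxE normrM ger0_norm //.
rewrite (bigD1 j) //= -[leLHS]addr0 lerD //; last exact: sumr_ge0.
rewrite ler_piMl // -l1 (bigD1 i) //= lerDl; exact: sumr_ge0.
Qed.

(** The simplex lies between two boxes of positive finite measure: a ball of the
    sup norm around the centroid, and a large cube. The upper bound matters as
    well, because the volume is defined to be 0 when the measure is infinite. *)
Lemma volume_simplex_gt0 : 0 < volume (conv_hull p).
Proof.
have [e e0 eK] := ball_centroid; have [r r0 Kr] := simplex_bounded.
have itvE (a b : R) : a < b -> lebesgue_measure [set` `[a, b]] = (b - a)%:E.
  by move=> ab; rewrite lebesgue_measure_itv /= lte_fin ab.
apply: fine_gt0; apply/andP; split.
  apply: (@lt_le_trans _ _ (lebesgue_rV R d (ball (centroid p) e))).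
    rewrite ball_rV // (lebesgue_rV_box (A := fun i =>
      [set` `]centroid p ord0 i - e, centroid p ord0 i + e[]));
      last by move=> i; exact: measurable_itv.
    rewrite (eq_bigr (fun=> (e + e)%:E)).
      by rewrite prodEFin lte_fin prodr_gt0 // => i _; rewrite addr_gt0.
    move=> i _; rewrite lebesgue_measure_itv /= lte_fin.
    rewrite (@lt_trans _ _ (centroid p ord0 i)) ?gtrBl ?ltrDl //.
    by rewrite -EFinB opprB addrC -addrA addKr.
  apply: le_measure => //; apply: mem_set; last exact: measurable_simplex.
  by apply: open_measurable_rV; exact: ball_open.
apply: (@le_lt_trans _ _ (lebesgue_rV R d
    [set x | forall i, [set` `[- r, r]] (x ord0 i)])).
  apply: le_measure => //; apply: mem_set; first exact: measurable_simplex.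
  by apply: (@measurable_rV_box _ _ (fun=> [set` `[- r, r]])) => i; exact: measurable_itv.
rewrite (lebesgue_rV_box (A := fun=> [set` `[- r, r]]));
  last by move=> i; exact: measurable_itv.
rewrite (eq_bigr (fun=> (r + r)%:E)) ?prodEFin ?ltry // => i _.
by rewrite itvE ?opprK // gtrN.
Qed.

End simplex.

(** * The oversampling patch contains the element *)

Section dilation.
Variables (R : realType) (d : nat).
Local Notation V := 'rV[R]_d.

Lemma conv_hull_convex n (p : 'I_n -> V) (t : R) x y : 0 <= t <= 1 ->
  conv_hull p x -> conv_hull p y -> conv_hull p (t *: x + (1 - t) *: y).
Proof.
move=> /andP[t0 t1] [l [l0 l1] ->] [m [m0 m1] ->].
exists (fun i => t * l i + (1 - t) * m i).
  split=> [i|]; first by rewrite addr_ge0 ?mulr_ge0 ?subr_ge0.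
  by rewrite big_split /= -!mulr_sumr l1 m1 !mulr1 addrC subrK.
rewrite !scaler_sumr -big_split; apply: eq_bigr => i _ /=.
by rewrite !scalerA -scalerDl.
Qed.

Lemma conv_hull_centroid (p : 'I_d.+1 -> V) : conv_hull p (centroid p).
Proof.
exists (fun=> d.+1%:R^-1); last by rewrite /centroid scaler_sumr.
by split=> //; rewrite sumr_const card_ord -[_ *+ _]mulr_natr mulVf.
Qed.

Lemma sub_oversampling_patch (Omega : set V) (p : 'I_d.+1 -> V) (r : R) :
  1 <= r -> conv_hull p `<=` Omega ->
  conv_hull p `<=` oversampling_patch Omega p r.
Proof.
move=> r1 pO x px; split; last exact: pO.
have r0 : 0 < r by exact: lt_le_trans r1.
(* The preimage of x under the homothety lies on the segment from the centroid
   to x because r is at least 1. *)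
exists (r^-1 *: x + (1 - r^-1) *: centroid p).
  apply: conv_hull_convex => //; last exact: conv_hull_centroid.
  by rewrite invr_ge0 ltW //= invf_le1.
rewrite /homothety scalerBl scale1r -addrA [_ - _ - _]addrAC subrr add0r.
by rewrite -scalerBr scalerA mulfV ?gt_eqF // scale1r addrC subrK.
Qed.

End dilation.

(** * Bilinear expansion on a subspace *)

Section bilinear_forms.
Variables (R : realType) (d : nat).
Local Notation V := 'rV[R]_d.

Definition subspace (X : set (V -> R)) :=
  X 0 /\ forall (c : R) u v, X u -> X v -> X (c *: u + v).

Lemma subspace_sum (X : set (V -> R)) (I : finType) (c : I -> R)
    (w : I -> V -> R) : subspace X -> (forall i, X (w i)) ->
  X (\sum_i c i *: w i).
Proof.
move=> [X0 Xlin] Xw; elim/big_rec: _ => // i u _; exact: Xlin.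
Qed.

Lemma linear_on_sum (X : set (V -> R)) (I : finType) (c : I -> R)
    (w : I -> V -> R) (l : (V -> R) -> R^o) :
  subspace X -> linear_on X l -> (forall i, X (w i)) ->
  l (\sum_i c i *: w i) = \sum_i c i * l (w i).
Proof.
move=> [X0 Xlin] ll Xw.
have l0 : l 0 = 0.
  have := ll 1 _ _ X0 X0; rewrite !scale1r addr0.
  by move=> /(congr1 (fun y => y - l 0)); rewrite subrr addrK => <-.
suff [_ ->] : X (\sum_i c i *: w i) /\
    l (\sum_i c i *: w i) = \sum_i c i * l (w i) by [].
elim/big_rec2: _ => // i y u _ [Xu lu]; split; first exact: Xlin.
by rewrite ll // lu.
Qed.

Lemma bilinear_on_sum (X : set (V -> R)) (a : (V -> R) -> (V -> R) -> R)
    (I : finType) (c e : I -> R) (w : I -> V -> R) :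
  subspace X -> bilinear_on X a -> (forall i, X (w i)) ->
  a (\sum_i c i *: w i) (\sum_j e j *: w j) =
  \sum_i \sum_j c i * e j * a (w i) (w j).
Proof.
move=> sX ba Xw; have Xe := subspace_sum e sX Xw.
rewrite (linear_on_sum c sX (ba _ Xe).2 Xw); apply: eq_bigr => i _.
rewrite (linear_on_sum e sX (ba _ (Xw i)).1 Xw) mulr_sumr.
by apply: eq_bigr => j _; rewrite mulrA.
Qed.

Lemma sum_option (F : option 'I_d -> R) :
  \sum_k F k = F None + \sum_k F (Some k).
Proof.
rewrite (bigD1 None) //= (reindex_omap Some id) => [|[i|]] //=.
by congr (_ + _); apply: eq_bigl => i; rewrite eqxx.
Qed.

(** The functions of X are only relevant on A: neither extension by 0 outside A
    nor any other change there affects membership. *)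
Definition restrictions (A : set V) (X : set (V -> R)) : set (V -> R) :=
  [set u | exists2 v, X v & forall x, A x -> u x = v x].

Lemma restrictions_subspace (A : set V) (X : set (V -> R)) :
  subspace X -> subspace (restrictions A X).
Proof.
move=> [X0 Xlin]; split; first by exists 0.
move=> c u v [u' Xu uu'] [v' Xv vv']; exists (c *: u' + v'); first exact: Xlin.
by move=> x Ax; rewrite !fctE uu' ?vv'.
Qed.

Lemma bilinear_onS (X Y : set (V -> R)) (a : (V -> R) -> (V -> R) -> R) :
  Y `<=` X -> bilinear_on X a -> bilinear_on Y a.
Proof.
move=> YX ba w /YX /ba[l1 l2].
by split=> c u v /YX Xu /YX Xv; [exact: l1|exact: l2].
Qed.

End bilinear_forms.

(** * The one-point rule is exact for the effective form *)

Section effective_coefficients.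
Variables (R : realType) (d : nat).
Local Notation V := 'rV[R]_d.
Variables (p : 'I_d.+1 -> V) (chi : option 'I_d -> V -> R).
Local Notation xc := (centroid p).
Local Notation W := (multiscale_mode p chi).

(** The coefficients of the Taylor expansion of v at the centroid. *)
Definition mode_coef (v : V -> R) (k : option 'I_d) : R :=
  if k is Some i then partial i v xc else v xc.

Lemma affine_affine_mode k : affine (affine_mode p k).
Proof.
case: k => [i|] /=.
  exists (- xc ord0 i), (fun k => (k == i)%:R) => x.
  rewrite (bigD1 i) //= eqxx mul1r big1 ?addr0 1?addrC // => j /negbTE ->.
  by rewrite mul0r.
by exists 1, (fun=> 0) => x; rewrite big1 ?addr0 // => j _; rewrite mul0r.
Qed.

(** First-order Taylor expansion at the centroid writes v in the affine modes;
    multiscale v adds the correctors with the same coefficients. *)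
Lemma multiscaleE (v : V -> R) : affine v ->
  multiscale p chi v = \sum_k mode_coef v k *: W k.
Proof.
move=> av; apply/funext => x.
have WE c k : (c *: W k) x = c * affine_mode p k x + c * chi k x.
  exact: mulrDr.
rewrite fct_sumE sum_option WE /= mulr1 /multiscale (affine_taylor av x xc).
rewrite [in RHS](eq_bigr _ (fun k _ => WE _ (Some k))) big_split /= addrACA.
rewrite -[LHS]addrA; congr (_ + (_ + _)).
by apply: eq_bigr => k _; rewrite (affine_partial_cst av k x xc).
Qed.

Variable a : (V -> R) -> (V -> R) -> R.
Variable X : set (V -> R).
Hypotheses (sX : subspace X) (ba : bilinear_on X a).
Hypotheses (X_affine : forall k, X (affine_mode p k)) (X_chi : forall k, X (chi k)).

Let X_mode k : X (W k).
Proof.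
by rewrite /multiscale_mode -[affine_mode p k]scale1r; exact: (sX.2).
Qed.

Let a_mode k l : a (W k) (affine_mode p l) + a (W k) (chi l) = a (W k) (W l).
Proof.
have := (ba (X_mode k)).1 1 _ _ (X_affine l) (X_chi l).
by rewrite /= !scale1r.
Qed.

(** Both sides equal the double sum of
    mode_coef u k * mode_coef v l * a (W k) (W l): the left-hand one because
    evaluating the integrand at the centroid produces these coefficients, the
    volume cancelling with its inverse in the effective coefficients; the
    right-hand one by multiscaleE and bilinearity. *)
Lemma one_point_effective_form (u v : V -> R) :
  Defs.nondegenerate p -> affine u -> affine v ->
  effective_form p a chi (one_point_rule p) u v =
  a (multiscale p chi u) (multiscale p chi v).
Proof.
move=> p_nd au av.
have vol0 : volume (conv_hull p) != 0 by rewrite gt_eqF ?volume_simplex_gt0.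
rewrite !multiscaleE // (bilinear_on_sum _ _ sX ba X_mode).
rewrite /effective_form /one_point_rule /effective_integrand.
set m := volume (conv_hull p) in vol0 *.
(* The index pairs are split into (Some, Some), (Some, None), (None, Some) and
   (None, None), the order of the effective integrand. *)
rewrite !mulrDr !sum_option /=.
rewrite [X in _ = _ + X](eq_bigr _ (fun k _ => sum_option _)) /=.
rewrite big_split /= [RHS]addrC [X in _ = X + _]addrC [X in _ = _ + X]addrC addrA.
congr (_ + _ + _ + _).
- rewrite exchange_big /= mulr_sumr; apply: eq_bigr => l _.
  rewrite mulrCA !mulr_sumr; apply: eq_bigr => k _.
  by rewrite /effA a_mode -/m; field.
- rewrite mulrCA !mulr_sumr; apply: eq_bigr => k _.
  by rewrite /effB1 a_mode -/m; field.
- rewrite mulrCA !mulr_sumr; apply: eq_bigr => l _.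
  by rewrite /effB2 a_mode -/m; field.
- by rewrite /effM a_mode -/m; field.
Qed.

End effective_coefficients.

(** * Equality of the two stiffness matrices *)

Theorem mainTheorem2 (R : realType) (d : nat) (d_gt0 : (0 < d)%N)
  (Omega : set 'rV[R]_d) (Omega_polytope : polytope Omega) (T : mesh Omega)
  (a : elt T -> ('rV[R]_d -> R) -> ('rV[R]_d -> R) -> R)
  (a_bilinear : forall K, bilinear_on (H1 (cell K)) (a K))
  (a_continuous : forall K, continuous_form (cell K) (a K))
  (a_coercive : coercive_H10 Omega (fun u v => \sum_K a K u v))
  (a_local_coercive : forall K, gradient_coercive (cell K) (a K))
  (f : 'rV[R]_d -> R) (f_L2 : L2 Omega f)
  (ty : msfem) (N N0 : nat) (leN0N : (N0 <= N)%N)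
  (phi : 'I_N -> elt T -> 'rV[R]_d -> R)
  (phi_dual : dual_to_sites ty phi)
  (phi_basis : is_basis (@VH R d Omega T ty) phi)
  (phi0_basis : is_basis (@VH0 R d Omega T ty)
                  (fun i : 'I_N0 => phi (widen_ord leN0N i)))
  (rho : elt T -> R) (rho_ge1 : forall K, 1 <= rho K)
  (S : elt T -> set 'rV[R]_d)
  (SE : forall K, S K = oversampling_patch Omega (vtx K) (rho K))
  (sigma : elt T -> 'I_d.+1 -> dof_site R d)
  (sigma_sites : forall K, patch_sites ty (vtx K) (S K) (sigma K))
  (sigma_bijective : forall K, dof_bijective (sigma K))
  (VK : elt T -> set ('rV[R]_d -> R))
  (s : elt T -> ('rV[R]_d -> R) -> ('rV[R]_d -> R) -> R)
  (GS : elt T -> ('rV[R]_d -> R) -> 'rV[R]_d.+1)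
  (VK_subspace : forall K, H1_subspace (S K) (VK K))
  (VK_P1 : forall K, @affine R d `<=` VK K)
  (s_form : forall K, form_on_classes (S K) (VK K) (s K))
  (GS_extension : forall K, dof_extension (S K) (sigma K) (VK K) (GS K))
  (s_well_posed : forall K, well_posed (S K) (VK K) (s K) (GS K) (GS K))
  (* the choice of DOF-extended or DOF-continuous correctors; GK is the DOF
     operator on K itself and is constrained in the second case only *)
  (var : dof_variant)
  (GK : elt T -> ('rV[R]_d -> R) -> 'rV[R]_d.+1)
  (GK_extension : var = DOF_continuous -> forall K,
    dof_extension (cell K) (simplex_sites ty (vtx K)) (VK K) (GK K))
  (GK_well_posed : var = DOF_continuous -> forall K,
    well_posed (S K) (VK K) (s K) (GS K) (GK K))
  (chiS : elt T -> option 'I_d -> 'rV[R]_d -> R)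
  (chiS_VK : forall K k, VK K (chiS K k))
  (chiS_equation : forall K k,
    corrector_equation (vtx K) (kernel_space (VK K) (GS K)) (s K) k (chiS K k))
  (chiS_dof : forall K k,
    match var with
    | DOF_extended => GS K (chiS K k) = 0
    | DOF_continuous => GK K (chiS K k) = 0
    end) :
  let chi K k := extend0 (cell K) (chiS K k) in
  let phi_eps (i : 'I_N) K := multiscale (vtx K) (chi K) (phi i K) in
  let idx (i : 'I_N0) : 'I_N := widen_ord leN0N i in
  let A_eps : 'M[R]_N0 := \matrix_(j, i)
    \sum_K a K (phi_eps (idx i) K) (phi_eps (idx j) K) in
  let A_P1 : 'M[R]_N0 := \matrix_(j, i)
    \sum_K effective_form (vtx K) (a K) (chi K) (one_point_rule (vtx K))
             (phi (idx i) K) (phi (idx j) K) in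
  A_eps = A_P1.
Proof.
move=> chi phi_eps idx A_eps A_P1; apply/matrixP => j i; rewrite !mxE.
apply: eq_bigr => K _.
have phi_affine l : affine (phi l K) by have [/(_ l)[/(_ K)]] := phi_basis.
have [VK_H1 VK0 VK_lin _] := VK_subspace K.
have sub_patch : cell K `<=` S K.
  rewrite SE; apply: sub_oversampling_patch; first exact: rho_ge1.
  by move=> x Kx; rewrite (mesh_cover T); exists K.
pose X := restrictions (cell K) (VK K).
have sX : subspace X by apply: restrictions_subspace.
have X_H1 : X `<=` H1 (cell K).
  by move=> u [v /VK_H1 Hv uv]; exact: H1_restrict sub_patch uv Hv.
apply/esym/(one_point_effective_form sX (bilinear_onS X_H1 (a_bilinear K))) => //.
- move=> k; exists (affine_mode (vtx K) k) => //.
  by apply: VK_P1; exact: affine_affine_mode.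
- by move=> k; exists (chiS K k) => // x Kx; rewrite /chi /extend0 mem_set.
- exact: mesh_nondegenerate.
Qed.
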